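(* Let $\Omega \subset \mathbb{C}$ be a domain. Then $\mathrm{Bloch}(\Omega) = 1 + \mathrm{g}(\Omega)$.
   Context: $\mathbb{D}$ is the open unit disk and $\mathrm{Hol}(\mathbb{D},\Omega)$ is the set of holomorphic maps on $\mathbb{D}$ with values in $\Omega$. A domain is a nonempty open connected subset of $\mathbb{C}$. For $\alpha\ge 0$ let $v_\alpha(z)=(1-|z|)^\alpha$, $z\in\mathbb{D}$. $\mathrm{H}^\infty_{v_\alpha}$ is the set of holomorphic $f\colon\mathbb{D}\to\mathbb{C}$ with $\sup_{z\in\mathbb{D}}|f(z)|v_\alpha(z)<+\infty$, and $\mathrm{g}(\Omega)=\inf\{\alpha>0:\mathrm{Hol}(\mathbb{D},\Omega)\subset\mathrm{H}^\infty_{v_\alpha}\}$. $\mathcal{B}_{v_\alpha}$ is the set of holomorphic $f\colon\mathbb{D}\to\mathbb{C}$ with $\sup_{z\in\mathbb{D}}|f'(z)|v_\alpha(z)<+\infty$, and $\mathrm{Bloch}(\Omega)=\inf\{\alpha>0:\mathrm{Hol}(\mathbb{D},\Omega)\subset\mathcal{B}_{v_\alpha}\}$. Conventions: $\inf(\emptyset)=+\infty$ and $1+(+\infty)=+\infty$. *)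

(* Defs.v *)
From Stdlib Require Import Reals.
From Coquelicot Require Import Coquelicot.
Open Scope R_scope.

Definition unit_disk (z : C) : Prop := Cmod z < 1.

(* Coquelicot's [is_connected] is only about subsets of R. *)
Definition connected (S : C -> Prop) : Prop :=
  forall U V : C -> Prop,
    open U -> open V ->
    (forall z, S z -> U z \/ V z) ->
    (exists z, S z /\ U z) ->
    (exists z, S z /\ V z) ->
    exists z, S z /\ U z /\ V z.

Definition complex_domain (Omega : C -> Prop) : Prop :=
  (exists z, Omega z) /\ open Omega /\ connected Omega.

(* A map on the disk is represented by a total function [C -> C] whose values
   outside the disk are irrelevant.  Since [C] is the variable's type,
   [ex_derive] is complex differentiability. *)
Definition holomorphic_on_disk (f : C -> C) : Prop :=
  forall z : C, unit_disk z -> ex_derive f z.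

Definition Hol (Omega : C -> Prop) (f : C -> C) : Prop :=
  holomorphic_on_disk f /\ forall z : C, unit_disk z -> Omega (f z).

(* Used only on the disk, where the base of [Rpower] is positive. *)
Definition v (alpha : R) (z : C) : R := Rpower (1 - Cmod z) alpha.

Definition sup_disk (h : C -> R) : Rbar :=
  Lub_Rbar (fun y : R => exists z : C, unit_disk z /\ y = h z).

Definition Hinf (alpha : R) (f : C -> C) : Prop :=
  holomorphic_on_disk f /\
  Rbar_lt (sup_disk (fun z => Cmod (f z) * v alpha z)) p_infty.

(* [C_derive f z] is the complex derivative wherever [f] is complex
   differentiable ([C_derive_correct]). *)
Definition Bloch_space (alpha : R) (f : C -> C) : Prop :=
  holomorphic_on_disk f /\
  Rbar_lt (sup_disk (fun z => Cmod (C_derive f z) * v alpha z)) p_infty.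

(* [Glb_Rbar] of the empty set is [p_infty]. *)
Definition g (Omega : C -> Prop) : Rbar :=
  Glb_Rbar (fun alpha : R =>
    0 < alpha /\ forall f : C -> C, Hol Omega f -> Hinf alpha f).

Definition Bloch (Omega : C -> Prop) : Rbar :=
  Glb_Rbar (fun alpha : R =>
    0 < alpha /\ forall f : C -> C, Hol Omega f -> Bloch_space alpha f).

(* Main.v *)
Require Import Defs.
From Stdlib Require Import Reals Lra Psatz IndefiniteDescription.
From Coquelicot Require Import Coquelicot.

(** A bound [|f| = O((1-|z|)^(-alpha))] and a bound
    [|f'| = O((1-|z|)^(-1-alpha))] are equivalent for [alpha > 0]: Cauchy's
    estimate gives one direction and integration along rays the other.  Hence the
    exponents admissible for [g], shifted by 1, are those above 1 admissible for
    [Bloch].  No exponent below 1 is admissible for [Bloch]: a disk in [Omega]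
    contains the image of an affine copy of the atomic inner function, whose
    derivative is of size [1/(1-|z|)] along a horocycle.  Cauchy's estimate comes
    from Goursat's theorem for [(f w - f z - (w-z) f'(z)) / (w-z)^2] on a square
    centred at [z], which is [o(1/|w-z|)] at [z], so that shrinking the square
    removes the singularity. *)

(** * Goursat's theorem on rectangles *)

(** Cauchy's estimate is the bottleneck, but only its order in the radius matters: any constant in
    place of 4 in [4 * M / s] leaves the exponents unchanged. This freedom allows axis-parallel
    squares instead of circles, real parts of contour integrals (four real Riemann integrals)
    instead of complex ones, and a crude one-sided bound instead of the exact value 2 pi i of the
    integral around a pole. At the exponent 1, integration along rays yields a logarithm and not a
    power. A Bloch exponent beta is therefore only shown to make beta - 1 + eps admissible for [g],
    for every eps > 0, and the infimum absorbs the loss. The bound beta >= 1 makes these exponents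
    positive, as the definition of [g] demands. The atomic inner function is suited to that bound
    because it is bounded and yet its derivative attains the order 1/(1-|z|), the largest that
    Cauchy's estimate allows to a bounded function. *)

Lemma is_C_derive_eps (f : C -> C) (z l : C) :
  is_derive f z l <->
  forall eps : R, 0 < eps -> exists delta : R, 0 < delta /\
    forall w : C, Cmod (w - z) < delta ->
      Cmod (f w - f z - (w - z) * l) <= eps * Cmod (w - z).
Proof.
  split.
  - intros [_ H] eps Heps.
    destruct (H z (fun P HP => HP) (mkposreal eps Heps)) as [d Hd].
    exists d; split; [apply cond_pos|].
    intros w Hw; exact (Hd w Hw).
  - intros H; split; [apply is_linear_scal_l|].
    intros x Hx eps.
    rewrite <- (is_filter_lim_locally_unique _ _ Hx).
    destruct (H eps (cond_pos eps)) as [d [Hd1 Hd2]].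
    exists (mkposreal d Hd1); intros w Hw; exact (Hd2 w Hw).
Qed.

Lemma im_le_Cmod (z : C) : Rabs (Im z) <= Cmod z.
Proof. eapply Rle_trans; [apply Rmax_r|apply (Rmax_Cmod z)]. Qed.

Lemma Cmod_le_abs (z : C) : Cmod z <= Rabs (Re z) + Rabs (Im z).
Proof.
  destruct z as [x y].
  replace (x, y) with (RtoC x + Ci * RtoC y)%C
    by (unfold RtoC, Ci, Cplus, Cmult; simpl; f_equal; ring).
  eapply Rle_trans; [apply Cmod_triangle|].
  rewrite Cmod_mult, Cmod_Ci, !Cmod_R.
  apply Req_le; unfold Re, Im; simpl.
  rewrite Rmult_1_l; f_equal; f_equal; ring.
Qed.

Lemma ex_C_derive_continuous (f : C -> C) (z : C) :
  ex_derive f z ->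
  forall eps : R, 0 < eps -> exists delta : R, 0 < delta /\
    forall w : C, Cmod (w - z) < delta -> Cmod (f w - f z) < eps.
Proof.
  intros [l Hl] eps Heps.
  destruct (proj1 (is_C_derive_eps f z l) Hl 1 Rlt_0_1) as [d [Hd H]].
  pose proof (Cmod_ge_0 l) as Hl0.
  assert (Hp : 0 < eps / (2 + Cmod l)) by (apply Rdiv_lt_0_compat; lra).
  exists (Rmin d (eps / (2 + Cmod l))); split; [apply Rmin_pos; assumption|].
  intros w Hw.
  assert (H1 : Cmod (w - z) < d) by (eapply Rlt_le_trans; [exact Hw|apply Rmin_l]).
  assert (H2 : Cmod (w - z) < eps / (2 + Cmod l))
    by (eapply Rlt_le_trans; [exact Hw|apply Rmin_r]).
  specialize (H w H1).
  replace (f w - f z)%C with ((f w - f z - (w - z) * l) + (w - z) * l)%C by ring.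
  eapply Rle_lt_trans; [apply Cmod_triangle|]. rewrite Cmod_mult.
  pose proof (Cmod_ge_0 (w - z)).
  apply Rle_lt_trans with (Cmod (w - z) * (2 + Cmod l)); [nra|].
  apply (Rmult_lt_compat_r (2 + Cmod l)) in H2; [|lra].
  replace (eps / (2 + Cmod l) * (2 + Cmod l)) with eps in H2 by (field; lra).
  exact H2.
Qed.

Lemma continuous_eps (f : R -> R) (x : R) :
  (forall eps : R, 0 < eps -> exists delta : R, 0 < delta /\
    forall t : R, Rabs (t - x) < delta -> Rabs (f t - f x) < eps) ->
  continuous f x.
Proof.
  intros H; apply filterlim_locally; intros eps.
  destruct (H eps (cond_pos eps)) as [d [Hd Hf]].
  exists (mkposreal d Hd); exact Hf.
Qed.

Lemma continuous_Re_horizontal (k : C -> C) (x y : R) :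
  ex_derive k (x, y) -> continuous (fun t => Re (k (t, y))) x.
Proof.
  intros Hk; apply continuous_eps; intros eps Heps.
  destruct (ex_C_derive_continuous k _ Hk eps Heps) as [d [Hd H]].
  exists d; split; [exact Hd|]; intros t Ht.
  eapply Rle_lt_trans; [apply (re_le_Cmod (k (t, y) - k (x, y))%C)|].
  apply H; eapply Rle_lt_trans; [apply Cmod_le_abs|].
  unfold Re, Im; simpl.
  replace (y + - y) with 0 by ring; rewrite Rabs_R0, Rplus_0_r; exact Ht.
Qed.

Lemma continuous_Im_vertical (k : C -> C) (x y : R) :
  ex_derive k (x, y) -> continuous (fun t => Im (k (x, t))) y.
Proof.
  intros Hk; apply continuous_eps; intros eps Heps.
  destruct (ex_C_derive_continuous k _ Hk eps Heps) as [d [Hd H]].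
  exists d; split; [exact Hd|]; intros t Ht.
  eapply Rle_lt_trans; [apply (im_le_Cmod (k (x, t) - k (x, y))%C)|].
  apply H; eapply Rle_lt_trans; [apply Cmod_le_abs|].
  unfold Re, Im; simpl.
  replace (x + - x) with 0 by ring; rewrite Rabs_R0, Rplus_0_l; exact Ht.
Qed.

(* The real part of the contour integral of [k dz] along the positively
   oriented boundary of the rectangle [[a,b] x [c,d]]. *)
Definition boundary_integral (k : C -> C) (a b c d : R) : R :=
  RInt (fun x => Re (k (x, c))) a b - RInt (fun x => Re (k (x, d))) a b
  - RInt (fun y => Im (k (b, y))) c d + RInt (fun y => Im (k (a, y))) c d.

Definition derivable_on_rect (k : C -> C) (a b c d : R) : Prop :=
  forall x y : R, a <= x <= b -> c <= y <= d -> ex_derive k (x, y).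

Lemma ex_RInt_horizontal (k : C -> C) (a b y : R) :
  a <= b -> (forall x, a <= x <= b -> ex_derive k (x, y)) ->
  ex_RInt (fun x => Re (k (x, y))) a b.
Proof.
  intros Hab H; apply (ex_RInt_continuous (V := R_CompleteNormedModule)); intros x Hx.
  rewrite Rmin_left, Rmax_right in Hx by exact Hab.
  apply continuous_Re_horizontal, H, Hx.
Qed.

Lemma ex_RInt_vertical (k : C -> C) (x c d : R) :
  c <= d -> (forall y, c <= y <= d -> ex_derive k (x, y)) ->
  ex_RInt (fun y => Im (k (x, y))) c d.
Proof.
  intros Hcd H; apply (ex_RInt_continuous (V := R_CompleteNormedModule)); intros y Hy.
  rewrite Rmin_left, Rmax_right in Hy by exact Hcd.
  apply continuous_Im_vertical, H, Hy.
Qed.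

(** The common side of the two pieces occurs as the same integral with opposite signs.
    Differentiability is asked only on the two sides being cut, so that the rectangle may enclose a
    singularity. *)
Lemma boundary_integral_split_x (k : C -> C) (a m b c d : R) :
  a <= m <= b -> c <= d ->
  (forall x, a <= x <= b -> ex_derive k (x, c)) ->
  (forall x, a <= x <= b -> ex_derive k (x, d)) ->
  boundary_integral k a b c d =
  boundary_integral k a m c d + boundary_integral k m b c d.
Proof.
  intros Hm Hcd Hc Hd; unfold boundary_integral.
  rewrite <- (RInt_Chasles (fun x => Re (k (x, c))) a m b)
    by (apply ex_RInt_horizontal; [lra|intros; apply Hc; lra]).
  rewrite <- (RInt_Chasles (fun x => Re (k (x, d))) a m b)
    by (apply ex_RInt_horizontal; [lra|intros; apply Hd; lra]).
  unfold plus; simpl; ring.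
Qed.

Lemma boundary_integral_split_y (k : C -> C) (a b c m d : R) :
  a <= b -> c <= m <= d ->
  (forall y, c <= y <= d -> ex_derive k (a, y)) ->
  (forall y, c <= y <= d -> ex_derive k (b, y)) ->
  boundary_integral k a b c d =
  boundary_integral k a b c m + boundary_integral k a b m d.
Proof.
  intros Hab Hm Ha Hb; unfold boundary_integral.
  rewrite <- (RInt_Chasles (fun y => Im (k (a, y))) c m d)
    by (apply ex_RInt_vertical; [lra|intros; apply Ha; lra]).
  rewrite <- (RInt_Chasles (fun y => Im (k (b, y))) c m d)
    by (apply ex_RInt_vertical; [lra|intros; apply Hb; lra]).
  unfold plus; simpl; ring.
Qed.

Lemma RInt_near_const (f : R -> R) (a b q e : R) :
  a <= b -> ex_RInt f a b ->
  (forall t, a <= t <= b -> Rabs (f t - q) <= e) ->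
  Rabs (RInt f a b - (b - a) * q) <= (b - a) * e.
Proof.
  intros Hab Hf H.
  assert (H1 : RInt f a b <= (b - a) * (q + e)).
  { replace ((b - a) * (q + e)) with (RInt (fun _ => q + e) a b)
      by exact (RInt_const (V := R_CompleteNormedModule) a b (q + e)).
    apply RInt_le; [exact Hab|exact Hf|apply ex_RInt_const|].
    intros t Ht; specialize (H t ltac:(lra)); apply Rabs_le_between in H; lra. }
  assert (H2 : (b - a) * (q - e) <= RInt f a b).
  { replace ((b - a) * (q - e)) with (RInt (fun _ => q - e) a b)
      by exact (RInt_const (V := R_CompleteNormedModule) a b (q - e)).
    apply RInt_le; [exact Hab|apply ex_RInt_const|exact Hf|].
    intros t Ht; specialize (H t ltac:(lra)); apply Rabs_le_between in H; lra. }
  apply Rabs_le; lra.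
Qed.

(** Affine functions have contour integral 0: opposite sides, taken together, differ by a constant,
    and both pairs integrate to [(b - a) * (d - c) * Im l], with opposite signs. Pairing sides
    doubles the error [e]. *)
Lemma boundary_integral_near_affine (k : C -> C) (a b c d e : R) (p l : C) :
  a <= b -> c <= d -> derivable_on_rect k a b c d ->
  (forall x y, a <= x <= b -> c <= y <= d ->
     Cmod (k (x, y) - k p - ((x, y) - p) * l) <= e) ->
  Rabs (boundary_integral k a b c d) <= 2 * e * ((b - a) + (d - c)).
Proof.
  intros Hab Hcd Hk He.
  assert (Hre : forall x y, a <= x <= b -> c <= y <= d ->
    Rabs (Re (k (x, y)) - Re (k p) - ((x - Re p) * Re l - (y - Im p) * Im l)) <= e).
  { intros x y Hx Hy; eapply Rle_trans; [|apply (He x y Hx Hy)].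
    eapply Rle_trans; [|apply re_le_Cmod].
    apply Req_le; f_equal; destruct p, l; unfold Re, Im; simpl; ring. }
  assert (Him : forall x y, a <= x <= b -> c <= y <= d ->
    Rabs (Im (k (x, y)) - Im (k p) - ((x - Re p) * Im l + (y - Im p) * Re l)) <= e).
  { intros x y Hx Hy; eapply Rle_trans; [|apply (He x y Hx Hy)].
    eapply Rle_trans; [|apply im_le_Cmod].
    apply Req_le; f_equal; destruct p, l; unfold Re, Im; simpl; ring. }
  assert (E1 := ex_RInt_horizontal k a b c Hab ltac:(intros; apply Hk; lra)).
  assert (E2 := ex_RInt_horizontal k a b d Hab ltac:(intros; apply Hk; lra)).
  assert (E3 := ex_RInt_vertical k a c d Hcd ltac:(intros; apply Hk; lra)).
  assert (E4 := ex_RInt_vertical k b c d Hcd ltac:(intros; apply Hk; lra)).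
  assert (H1 := RInt_near_const _ a b (Im l * (d - c)) (2 * e) Hab
    (ex_RInt_minus (V := R_NormedModule) _ _ _ _ E1 E2)).
  assert (H2 := RInt_near_const _ c d (Im l * (b - a)) (2 * e) Hcd
    (ex_RInt_minus (V := R_NormedModule) _ _ _ _ E4 E3)).
  rewrite (RInt_minus (V := R_CompleteNormedModule)) in H1 by assumption.
  rewrite (RInt_minus (V := R_CompleteNormedModule)) in H2 by assumption.
  unfold minus, plus, opp in H1, H2; simpl in H1, H2.
  lapply H1; clear H1; [intros H1|].
  2: { intros t Ht. pose proof (Hre t c Ht ltac:(lra)) as K1.
       pose proof (Hre t d Ht ltac:(lra)) as K2.
       apply Rabs_le_between in K1; apply Rabs_le_between in K2.
       apply Rabs_le; lra. }
  lapply H2; clear H2; [intros H2|].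
  2: { intros t Ht. pose proof (Him a t ltac:(lra) Ht) as K1.
       pose proof (Him b t ltac:(lra) Ht) as K2.
       apply Rabs_le_between in K1; apply Rabs_le_between in K2.
       apply Rabs_le; lra. }
  apply Rabs_le_between in H1; apply Rabs_le_between in H2.
  unfold boundary_integral; apply Rabs_le; lra.
Qed.

(** Left ends increase and right ends decrease, so the supremum of the left ends lies in every
    interval. Bisected rectangles are handled by applying this to each coordinate. *)
Lemma nested_point (x : nat -> R) (s : R) :
  (forall n, x n <= x (S n) <= x n + s / 2 ^ S n) ->
  exists p, forall n, x n <= p <= x n + s / 2 ^ n.
Proof.
  intros H.
  assert (Hs : 0 <= s) by (specialize (H 0%nat); simpl in H; lra).
  assert (Hpos : forall n, 0 <= s / 2 ^ n)
    by (intros n; apply Rle_mult_inv_pos; [exact Hs|apply pow_lt; lra]).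
  assert (Hhalf : forall n, s / 2 ^ n = s / 2 ^ S n + s / 2 ^ S n)
    by (intros n; simpl; field; apply pow_nonzero; lra).
  assert (Hmono : forall n i, x n <= x (i + n)%nat).
  { intros n i; induction i as [|i IH]; simpl; [lra|].
    destruct (H (i + n)%nat); lra. }
  assert (Hup : forall n i, x (i + n)%nat + s / 2 ^ (i + n) <= x n + s / 2 ^ n).
  { intros n i; induction i as [|i IH]; [simpl; lra|].
    change (S i + n)%nat with (S (i + n)).
    destruct (H (i + n)%nat); specialize (Hhalf (i + n)%nat); lra. }
  assert (Hub : forall m n, x m <= x n + s / 2 ^ n).
  { intros m n; destruct (Nat.le_ge_cases m n) as [Hmn|Hmn].
    - replace n with ((n - m) + m)%nat by lia.
      specialize (Hmono m (n - m)%nat); specialize (Hpos (n - m + m)%nat); lra.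
    - replace m with ((m - n) + n)%nat by lia.
      specialize (Hup n (m - n)%nat); specialize (Hpos (m - n + n)%nat); lra. }
  destruct (completeness (fun r => exists n, r = x n)) as [p [Hp1 Hp2]].
  - exists (x 0%nat + s / 2 ^ 0); intros r [n ->]; apply Hub.
  - exists (x 0%nat), 0%nat; reflexivity.
  - exists p; intros n; split.
    + apply Hp1; exists n; reflexivity.
    + apply Hp2; intros r [m ->]; apply Hub.
Qed.

(** Bisection: if the integral has modulus [eta > 0], some rectangle of level n carries at least
    [eta / 4 ^ n]. At the limit point [k] is affine up to eps times the diameter; perimeter times
    diameter also decays like [/ 4 ^ n], and the factor eps gives the contradiction. *)
Lemma goursat (k : C -> C) (a b c d : R) :
  a <= b -> c <= d -> derivable_on_rect k a b c d ->
  boundary_integral k a b c d = 0.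
Proof.
  intros Hab Hcd Hk.
  destruct (Req_dec (boundary_integral k a b c d) 0) as [E|E]; [exact E|exfalso].
  set (eta := Rabs (boundary_integral k a b c d)).
  assert (Heta : 0 < eta) by (apply Rabs_pos_lt, E).
  set (s := b - a); set (t := d - c).
  assert (Hs : 0 <= s) by (unfold s; lra).
  assert (Ht : 0 <= t) by (unfold t; lra).
  set (bad := fun (n : nat) (q : R * R) =>
    a <= fst q /\ fst q + s / 2 ^ n <= b /\ c <= snd q /\ snd q + t / 2 ^ n <= d /\
    eta / 4 ^ n <= Rabs (boundary_integral k (fst q) (fst q + s / 2 ^ n)
                                             (snd q) (snd q + t / 2 ^ n))).
  set (step := fun (n : nat) (q q' : R * R) =>
    fst q <= fst q' <= fst q + s / 2 ^ S n /\
    snd q <= snd q' <= snd q + t / 2 ^ S n).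
  assert (Hpos : forall r n, 0 <= r -> 0 <= r / 2 ^ n)
    by (intros; apply Rle_mult_inv_pos; [assumption|apply pow_lt; lra]).
  assert (Hhalf : forall r n, r / 2 ^ n = r / 2 ^ S n + r / 2 ^ S n)
    by (intros r n; simpl; field; apply pow_nonzero; lra).
  (* The implication stands under the existential so that choice yields a total function [next];
     badness is supplied afterwards by induction. *)
  assert (Hstep : forall nq : nat * (R * R), exists q',
    bad (fst nq) (snd nq) -> bad (S (fst nq)) q' /\ step (fst nq) (snd nq) q').
  { intros [n [x y]]; cbn [fst snd].
    destruct (Classical_Prop.classic (bad n (x, y))) as [Hb|Hb];
      [|exists (x, y); tauto].
    unfold bad in Hb; cbn [fst snd] in Hb.
    destruct Hb as (Ha1 & Hb1 & Hc1 & Hd1 & Hb).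
    pose proof (Hpos s (S n) Hs) as Ps; pose proof (Hpos t (S n) Ht) as Pt.
    assert (Q : eta / 4 ^ n = 4 * (eta / 4 ^ S n))
      by (simpl; field; apply pow_nonzero; lra).
    rewrite Q, (Hhalf s n), (Hhalf t n) in Hb.
    rewrite (Hhalf s n) in Hb1; rewrite (Hhalf t n) in Hd1.
    unfold bad, step; cbn [fst snd].
    set (s' := s / 2 ^ S n) in *; set (t' := t / 2 ^ S n) in *;
      set (e' := eta / 4 ^ S n) in *.
    rewrite <- !Rplus_assoc in Hb.
    rewrite (boundary_integral_split_x k x (x + s') (x + s' + s')) in Hb
      by (try lra; intros; apply Hk; lra).
    rewrite (boundary_integral_split_y k x (x + s') y (y + t') (y + t' + t')) in Hb
      by (try lra; intros; apply Hk; lra).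
    rewrite (boundary_integral_split_y k (x + s') (x + s' + s') y (y + t')) in Hb
      by (try lra; intros; apply Hk; lra).
    destruct (Rle_dec e' (Rabs (boundary_integral k x (x + s') y (y + t')))).
    { exists (x, y); cbn [fst snd]; intros _; repeat split; lra. }
    destruct (Rle_dec e' (Rabs (boundary_integral k x (x + s') (y + t') (y + t' + t')))).
    { exists (x, y + t'); cbn [fst snd]; intros _; repeat split; lra. }
    destruct (Rle_dec e' (Rabs (boundary_integral k (x + s') (x + s' + s') y (y + t')))).
    { exists (x + s', y); cbn [fst snd]; intros _; repeat split; lra. }
    (* Three quarters lie below [e'] and the sum is at least [4 * e'], so the triangle inequality
       singles out the last quarter. *)
    exists (x + s', y + t'); cbn [fst snd]; intros _; repeat split; try lra.
    revert Hb.
    match goal with |- _ <= Rabs (?A + ?B + (?X + ?Y)) -> _ =>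
      pose proof (Rabs_triang (A + B) (X + Y));
      pose proof (Rabs_triang A B); pose proof (Rabs_triang X Y) end.
    lra. }
  destruct (functional_choice _ Hstep) as [next Hnext].
  pose (u := fix u (n : nat) : R * R :=
    match n with O => (a, c) | S m => next (m, u m) end).
  assert (Hu : forall n, bad n (u n)).
  { induction n as [|n IH].
    - unfold bad; simpl; unfold Rdiv; rewrite !Rinv_1, !Rmult_1_r.
      replace (a + s) with b by (unfold s; ring).
      replace (c + t) with d by (unfold t; ring).
      repeat split; try lra; apply Rle_refl.
    - exact (proj1 (Hnext (n, u n) IH)). }
  assert (Hst : forall n, step n (u n) (u (S n)))
    by (intros n; exact (proj2 (Hnext (n, u n) (Hu n)))).
  destruct (nested_point (fun n => fst (u n)) s (fun n => proj1 (Hst n))) as [px Hpx].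
  destruct (nested_point (fun n => snd (u n)) t (fun n => proj2 (Hst n))) as [py Hpy].
  assert (Hp : ex_derive k (px, py)).
  { destruct (Hu 0%nat) as (A1 & A2 & A3 & A4 & _).
    specialize (Hpx 0%nat); specialize (Hpy 0%nat); apply Hk; lra. }
  destruct Hp as [l Hl].
  (* Makes the final bound [2 * eps * (s + t) ^ 2] at most [eta / 2]. The summand 1 keeps the
     denominator positive for degenerate rectangles. *)
  set (eps := eta / (4 * ((s + t) * (s + t) + 1))).
  assert (Hst2 : 0 < (s + t) * (s + t) + 1) by nra.
  assert (Heps : 0 < eps) by (apply Rdiv_lt_0_compat; lra).
  destruct (proj1 (is_C_derive_eps k _ l) Hl eps Heps) as [dl [Hdl Hd]].
  assert (Hsmall : exists n, (s + t) / 2 ^ n < dl).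
  { destruct (pow_lt_1_zero (/ 2) ltac:(rewrite Rabs_pos_eq; lra)
      (dl / (s + t + 1)) ltac:(apply Rdiv_lt_0_compat; lra)) as [N HN].
    exists N; specialize (HN N (Nat.le_refl N)).
    rewrite Rabs_pos_eq, pow_inv in HN by (apply pow_le; lra).
    apply (Rmult_lt_compat_l (s + t + 1)) in HN; [|lra].
    replace ((s + t + 1) * (dl / (s + t + 1))) with dl in HN by (field; lra).
    unfold Rdiv; assert (0 < / 2 ^ N) by (apply Rinv_0_lt_compat, pow_lt; lra); lra. }
  destruct Hsmall as [n Hn].
  destruct (Hu n) as (A1 & A2 & A3 & A4 & A5).
  specialize (Hpx n); specialize (Hpy n); cbn beta in Hpx, Hpy.
  set (x := fst (u n)) in *; set (y := snd (u n)) in *.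
  pose proof (Hpos s n Hs) as Ps; pose proof (Hpos t n Ht) as Pt.
  assert (Dst : (s + t) / 2 ^ n = s / 2 ^ n + t / 2 ^ n) by (unfold Rdiv; ring).
  assert (B := boundary_integral_near_affine k x (x + s / 2 ^ n) y (y + t / 2 ^ n)
    (eps * ((s + t) / 2 ^ n)) (px, py) l ltac:(lra) ltac:(lra)
    ltac:(intros x' y' Hx' Hy'; apply Hk; lra)).
  lapply B; clear B; [intros B|].
  2: { intros x' y' Hx' Hy'.
    assert (M : Cmod ((x', y') - (px, py)) <= (s + t) / 2 ^ n).
    { eapply Rle_trans; [apply Cmod_le_abs|]; unfold Re, Im; simpl; rewrite Dst.
      apply Rplus_le_compat; apply Rabs_le; lra. }
    eapply Rle_trans; [apply Hd; lra|].
    apply Rmult_le_compat_l; lra. }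
  assert (F : eta / 4 ^ n <= 2 * eps * ((s + t) * (s + t)) / 4 ^ n).
  { eapply Rle_trans; [exact A5|]; eapply Rle_trans; [exact B|].
    apply Req_le.
    replace (x + s / 2 ^ n - x + (y + t / 2 ^ n - y)) with ((s + t) / 2 ^ n)
      by (rewrite Dst; ring).
    replace (4 ^ n) with (2 ^ n * 2 ^ n)
      by (rewrite <- Rpow_mult_distr; f_equal; ring).
    field; apply pow_nonzero; lra. }
  apply (Rmult_le_compat_r (4 ^ n)) in F; [|apply pow_le; lra].
  assert (4 ^ n <> 0) by (apply pow_nonzero; lra).
  replace (eta / 4 ^ n * 4 ^ n) with eta in F by (field; assumption).
  replace (2 * eps * ((s + t) * (s + t)) / 4 ^ n * 4 ^ n)
    with (2 * (eps * ((s + t) * (s + t)))) in F by (field; assumption).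
  assert (G : eps * ((s + t) * (s + t) + 1) = eta / 4) by (unfold eps; field; lra).
  nra.
Qed.

(** * Cauchy's estimate *)

(* Coquelicot's product and chain rules are about the second of these two
   non-convertible normed-module structures on [C]. *)
Lemma is_C_derive_AbsRing (f : C -> C) (z l : C) :
  is_derive (V := C_NormedModule) f z l <->
  is_derive (V := AbsRing_NormedModule C_AbsRing) f z l.
Proof.
  split; intros [_ H]; split; [apply is_linear_scal_l|exact H| |exact H].
  apply is_linear_scal_l.
Qed.

Lemma is_C_derive_mult (f h : C -> C) (z df dh : C) :
  is_derive f z df -> is_derive h z dh ->
  is_derive (fun w => (f w * h w)%C) z (df * h z + f z * dh)%C.
Proof.
  intros Hf Hh; apply is_C_derive_AbsRing.
  exact (is_derive_mult (K := C_AbsRing) f h z df dh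
    (proj1 (is_C_derive_AbsRing _ _ _) Hf) (proj1 (is_C_derive_AbsRing _ _ _) Hh)
    Cmult_comm).
Qed.

Lemma is_C_derive_comp (f h : C -> C) (z df dh : C) :
  is_derive f (h z) df -> is_derive h z dh ->
  is_derive (fun w => f (h w)) z (dh * df)%C.
Proof.
  intros Hf Hh.
  exact (is_derive_comp (K := C_AbsRing) (V := C_NormedModule) f h z df dh
    Hf (proj1 (is_C_derive_AbsRing _ _ _) Hh)).
Qed.

Lemma is_C_derive_id (z : C) : is_derive (fun w : C => w) z (RtoC 1).
Proof. apply is_C_derive_AbsRing; exact (is_derive_id (K := C_AbsRing) z). Qed.

Lemma is_C_derive_const (c z : C) : is_derive (fun _ : C => c) z (RtoC 0).
Proof. exact (is_derive_const (V := C_NormedModule) c z). Qed.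

Lemma ex_C_derive_mult (f h : C -> C) (z : C) :
  ex_derive f z -> ex_derive h z -> ex_derive (fun w => (f w * h w)%C) z.
Proof. intros [df Hf] [dh Hh]; eexists; apply is_C_derive_mult; eassumption. Qed.

Lemma ex_C_derive_sub_const (f : C -> C) (z c : C) :
  ex_derive f z -> ex_derive (fun w => (f w - c)%C) z.
Proof.
  intros Hf; apply (ex_derive_minus (V := C_NormedModule)); [exact Hf|].
  apply ex_derive_const.
Qed.

Lemma is_C_derive_inv (z : C) :
  z <> 0 -> is_derive (fun w : C => (/ w)%C) z (- / (z * z))%C.
Proof.
  intros Hz; apply is_C_derive_eps; intros eps Heps.
  pose proof (proj1 (Cmod_gt_0 z) Hz) as Hm.
  set (m := Cmod z) in *.
  (* The remainder is exactly (w-z)^2 / (z^2 w). The first bound gives |w| > m/2, the second then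
     makes the remainder at most eps |w-z|. *)
  exists (Rmin (m / 2) (eps * (m * m * m) / 2)); split.
  { apply Rmin_pos; [lra|]. repeat apply Rmult_lt_0_compat; lra. }
  intros w Hw.
  assert (H1 : Cmod (w - z) < m / 2) by (eapply Rlt_le_trans; [exact Hw|apply Rmin_l]).
  assert (H2 : Cmod (w - z) < eps * (m * m * m) / 2)
    by (eapply Rlt_le_trans; [exact Hw|apply Rmin_r]).
  assert (Hwm : m / 2 < Cmod w).
  { pose proof (Cmod_triangle w (- (w - z))%C) as T.
    replace (w + - (w - z))%C with z in T by ring.
    rewrite Cmod_opp in T; fold m in T; lra. }
  assert (Hw0 : w <> 0) by (apply Cmod_gt_0; lra).
  replace (/ w - / z - (w - z) * - / (z * z))%C
    with ((w - z) * (w - z) * / (z * z * w))%C by (field; tauto).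
  assert (Hzzw : (z * z * w)%C <> 0) by (repeat apply Cmult_neq_0; assumption).
  rewrite Cmod_mult, Cmod_inv, !Cmod_mult by exact Hzzw; fold m.
  rewrite (Rmult_comm eps), Rmult_assoc.
  apply Rmult_le_compat_l; [apply Cmod_ge_0|].
  assert (Hmm : 0 < m * m * Cmod w) by (repeat apply Rmult_lt_0_compat; lra).
  apply (Rmult_le_reg_r (m * m * Cmod w)); [exact Hmm|].
  rewrite Rmult_assoc, Rinv_l, Rmult_1_r by lra.
  assert (0 < eps * (m * m)) by (repeat apply Rmult_lt_0_compat; lra).
  assert (eps * (m * m) * (m / 2) <= eps * (m * m) * Cmod w)
    by (apply Rmult_le_compat_l; lra).
  lra.
Qed.

(** * Contour integrals around an isolated singularity *)

(** The bounds are one-sided, each with the sign its side carries in the contour integral. In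
    [cauchy_estimate] the pole contributes negatively on all four sides, a gain that an absolute
    bound would lose. *)
Lemma boundary_integral_le (k : C -> C) (a b c d m : R) :
  a <= b -> c <= d ->
  (forall x, a <= x <= b -> ex_derive k (x, c) /\ Re (k (x, c)) <= m) ->
  (forall x, a <= x <= b -> ex_derive k (x, d) /\ - Re (k (x, d)) <= m) ->
  (forall y, c <= y <= d -> ex_derive k (b, y) /\ - Im (k (b, y)) <= m) ->
  (forall y, c <= y <= d -> ex_derive k (a, y) /\ Im (k (a, y)) <= m) ->
  boundary_integral k a b c d <= 2 * ((b - a) + (d - c)) * m.
Proof.
  intros Hab Hcd Hc Hd Hb Ha.
  assert (E : forall f p q, p <= q -> ex_RInt f p q ->
    (forall t, p <= t <= q -> f t <= m) -> RInt f p q <= (q - p) * m).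
  { intros f p q Hpq Hf H.
    replace ((q - p) * m) with (RInt (fun _ => m) p q)
      by exact (RInt_const (V := R_CompleteNormedModule) p q m).
    apply RInt_le; [exact Hpq|exact Hf|apply ex_RInt_const|intros; apply H; lra]. }
  assert (Ed := ex_RInt_horizontal k a b d Hab (fun x Hx => proj1 (Hd x Hx))).
  assert (Eb := ex_RInt_vertical k b c d Hcd (fun x Hx => proj1 (Hb x Hx))).
  assert (K1 := E _ a b Hab (ex_RInt_horizontal k a b c Hab (fun x Hx => proj1 (Hc x Hx)))
    (fun x Hx => proj2 (Hc x Hx))).
  assert (K2 := E _ c d Hcd (ex_RInt_vertical k a c d Hcd (fun x Hx => proj1 (Ha x Hx)))
    (fun x Hx => proj2 (Ha x Hx))).
  assert (K3 := E _ a b Hab (ex_RInt_opp (V := R_NormedModule) _ _ _ Ed)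
    (fun x Hx => proj2 (Hd x Hx))).
  assert (K4 := E _ c d Hcd (ex_RInt_opp (V := R_NormedModule) _ _ _ Eb)
    (fun x Hx => proj2 (Hb x Hx))).
  rewrite (RInt_opp (V := R_CompleteNormedModule)) in K3, K4 by assumption.
  unfold opp in K3, K4; simpl in K3, K4.
  unfold boundary_integral; lra.
Qed.

Lemma boundary_integral_abs_le (k : C -> C) (a b c d m : R) :
  a <= b -> c <= d ->
  (forall x y, a <= x <= b -> c <= y <= d -> x = a \/ x = b \/ y = c \/ y = d ->
     ex_derive k (x, y) /\ Cmod (k (x, y)) <= m) ->
  Rabs (boundary_integral k a b c d) <= 2 * ((b - a) + (d - c)) * m.
Proof.
  intros Hab Hcd H.
  assert (HR : forall w, Rabs (Re (k w)) <= Cmod (k w)) by (intros; apply re_le_Cmod).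
  assert (HI : forall w, Rabs (Im (k w)) <= Cmod (k w)) by (intros; apply im_le_Cmod).
  assert (Kh : forall y, c <= y <= d -> y = c \/ y = d ->
    Rabs (RInt (fun x => Re (k (x, y))) a b) <= (b - a) * m).
  { intros y Hy Hy'; apply abs_RInt_le_const; [exact Hab| |].
    - apply ex_RInt_horizontal; [exact Hab|]; intros x Hx; apply H; tauto.
    - intros x Hx; destruct (H x y Hx Hy ltac:(tauto)); specialize (HR (x, y)); lra. }
  assert (Kv : forall x, a <= x <= b -> x = a \/ x = b ->
    Rabs (RInt (fun y => Im (k (x, y))) c d) <= (d - c) * m).
  { intros x Hx Hx'; apply abs_RInt_le_const; [exact Hcd| |].
    - apply ex_RInt_vertical; [exact Hcd|]; intros y Hy; apply H; tauto.
    - intros y Hy; destruct (H x y Hx Hy ltac:(tauto)); specialize (HI (x, y)); lra. }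
  pose proof (Kh c ltac:(lra) ltac:(tauto)) as K1; apply Rabs_le_between in K1.
  pose proof (Kh d ltac:(lra) ltac:(tauto)) as K2; apply Rabs_le_between in K2.
  pose proof (Kv a ltac:(lra) ltac:(tauto)) as K3; apply Rabs_le_between in K3.
  pose proof (Kv b ltac:(lra) ltac:(tauto)) as K4; apply Rabs_le_between in K4.
  unfold boundary_integral; apply Rabs_le; lra.
Qed.

(** The region between the two squares is cut into four rectangles avoiding the centre: two strips
    of full height, and one piece below and one above the inner square. [goursat] removes each. *)
Lemma boundary_integral_annulus (k : C -> C) (x0 y0 s t : R) :
  0 < t <= s ->
  (forall x y, x0 - s <= x <= x0 + s -> y0 - s <= y <= y0 + s ->
     (x, y) <> (x0, y0) -> ex_derive k (x, y)) ->
  boundary_integral k (x0 - s) (x0 + s) (y0 - s) (y0 + s) =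
  boundary_integral k (x0 - t) (x0 + t) (y0 - t) (y0 + t).
Proof.
  intros Ht Hk.
  assert (Hx : forall x y, x0 - s <= x <= x0 + s -> y0 - s <= y <= y0 + s ->
    x <> x0 -> ex_derive k (x, y))
    by (intros; apply Hk; [assumption|assumption|congruence]).
  assert (Hy : forall x y, x0 - s <= x <= x0 + s -> y0 - s <= y <= y0 + s ->
    y <> y0 -> ex_derive k (x, y))
    by (intros; apply Hk; [assumption|assumption|congruence]).
  rewrite (boundary_integral_split_x k (x0 - s) (x0 - t) (x0 + s))
    by (try lra; intros; apply Hy; lra).
  rewrite (boundary_integral_split_x k (x0 - t) (x0 + t) (x0 + s))
    by (try lra; intros; apply Hy; lra).
  rewrite (boundary_integral_split_y k (x0 - t) (x0 + t) (y0 - s) (y0 - t))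
    by (try lra; intros; apply Hx; lra).
  rewrite (boundary_integral_split_y k (x0 - t) (x0 + t) (y0 - t) (y0 + t))
    by (try lra; intros; apply Hx; lra).
  rewrite (goursat k (x0 - s) (x0 - t)) by (try lra; intros x y A B; apply Hx; lra).
  rewrite (goursat k (x0 + t) (x0 + s)) by (try lra; intros x y A B; apply Hx; lra).
  rewrite (goursat k (x0 - t) (x0 + t) (y0 - s)) by (try lra; intros x y A B; apply Hy; lra).
  rewrite (goursat k (x0 - t) (x0 + t) (y0 + t)) by (try lra; intros x y A B; apply Hy; lra).
  ring.
Qed.

(** The singularity of [k] is too weak to make its contour integral negative. On the boundary, [k]
    is a part of modulus at most 2M|l|/s^2 plus a pole that contributes at most -4|l|^2 (exactly, -2
    pi |l|^2). With perimeter 8s this yields 4|l|^2 <= 16M|l|/s. *)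
Lemma cauchy_estimate (f : C -> C) (z l : C) (s M : R) :
  0 < s -> is_derive f z l ->
  (forall w : C, Rabs (Re w - Re z) <= s -> Rabs (Im w - Im z) <= s ->
     ex_derive f w /\ Cmod (f w) <= M) ->
  Cmod l <= 4 * M / s.
Proof.
  intros Hs Hl Hf.
  destruct z as [x0 y0]; set (z := (x0, y0) : C) in *.
  unfold Re, Im in Hf; cbn [fst snd z] in Hf.
  (* The factors [conj l] and [-i] give [k] the residue [i |l|^2], whose
     contribution to the contour integral is real. *)
  set (L := Cconj l).
  set (X := fun w : C => ((L * (f w - f z) - L * l * (w - z)) / ((w - z) * (w - z)))%C).
  set (k := fun w : C => (- Ci * X w)%C).
  assert (HLm : Cmod L = Cmod l) by apply Cmod_conj.
  assert (HLl : (L * l)%C = RtoC (Cmod l ^ 2))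
    by (unfold L; rewrite Cmod2_conj; ring).
  set (n := Cmod l) in *.
  assert (Hn : 0 <= n) by apply Cmod_ge_0.
  assert (HM : 0 <= M).
  { destruct (Hf z) as [_ Hz]; [| |pose proof (Cmod_ge_0 (f z)); lra];
      unfold z; cbn [fst snd]; rewrite Rminus_diag, Rabs_R0; lra. }
  assert (Hfz : Cmod (f z) <= M).
  { apply Hf; unfold z; cbn [fst snd]; rewrite Rminus_diag, Rabs_R0; lra. }
  assert (Hkd : forall w : C, w <> z -> ex_derive f w -> ex_derive k w).
  { intros w Hw Hfw; unfold k, X, Cdiv.
    apply ex_C_derive_mult; [apply ex_derive_const|].
    apply ex_C_derive_mult.
    - apply (ex_derive_minus (V := C_NormedModule)).
      + apply ex_C_derive_mult; [apply ex_derive_const|].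
        apply ex_C_derive_sub_const, Hfw.
      + apply ex_C_derive_mult; [apply ex_derive_const|].
        apply ex_C_derive_sub_const; eexists; apply is_C_derive_id.
    - assert (D : ex_derive (fun w : C => (w - z)%C) w)
        by (apply ex_C_derive_sub_const; eexists; apply is_C_derive_id).
      destruct (ex_C_derive_mult _ _ w D D) as [d Hd].
      eexists; apply (is_C_derive_comp Cinv); [apply is_C_derive_inv|exact Hd].
      apply Cmult_neq_0; intros E; apply Hw;
        rewrite <- (Cplus_0_r z), <- E; ring. }
  assert (Hsq : forall x y, x0 - s <= x <= x0 + s -> y0 - s <= y <= y0 + s ->
    (x, y) <> (x0, y0) -> ex_derive k (x, y)).
  { intros x y Hx Hy Hne; apply Hkd; [exact Hne|].
    apply Hf; cbn [fst snd]; apply Rabs_le; lra. }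
  assert (Hge : 0 <= boundary_integral k (x0 - s) (x0 + s) (y0 - s) (y0 + s)).
  { apply Rnot_lt_le; intros Hneg.
    set (B := boundary_integral k (x0 - s) (x0 + s) (y0 - s) (y0 + s)) in *.
    (* On the square of half-side t, perimeter times maximum is [8 * t * (n * eps / t)], independent
       of t; this eps makes it smaller than [- B]. *)
    set (eps := - B / (16 * (n + 1))).
    assert (Heps : 0 < eps) by (apply Rdiv_lt_0_compat; lra).
    destruct (proj1 (is_C_derive_eps f z l) Hl eps Heps) as [dl [Hdl Hd]].
    (* Points of the small square are within [2 * t] of the centre, hence strictly within [dl]. *)
    set (t := Rmin s (dl / 3)).
    assert (Ht : 0 < t) by (apply Rmin_pos; lra).
    assert (Hts : t <= s) by apply Rmin_l.
    assert (Htd : t <= dl / 3) by apply Rmin_r.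
    assert (Bt : B = boundary_integral k (x0 - t) (x0 + t) (y0 - t) (y0 + t))
      by (apply boundary_integral_annulus; [lra|exact Hsq]).
    assert (A := boundary_integral_abs_le k (x0 - t) (x0 + t) (y0 - t) (y0 + t)
      (n * eps / t) ltac:(lra) ltac:(lra)).
    lapply A; clear A; [intros A|].
    - rewrite <- Bt in A; apply Rabs_le_between in A.
      replace (2 * (x0 + t - (x0 - t) + (y0 + t - (y0 - t))) * (n * eps / t))
        with (8 * (n * eps)) in A by (field; lra).
      assert (eps * (n + 1) = - B / 16) by (unfold eps; field; lra).
      nra.
    - intros x y Hx Hy Hb.
      assert (Hw : t <= Cmod ((x, y) - z)).
      { destruct Hb as [Hb|[Hb|[Hb|Hb]]].
        1,2: eapply Rle_trans; [|apply re_le_Cmod].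
        3,4: eapply Rle_trans; [|apply im_le_Cmod].
        all: unfold z, Re, Im; simpl; rewrite Hb.
        1,3: rewrite <- Rabs_Ropp. all: rewrite Rabs_pos_eq; lra. }
      assert (Hw2 : Cmod ((x, y) - z) < dl).
      { eapply Rle_lt_trans; [apply Cmod_le_abs|]; unfold z, Re, Im; simpl.
        assert (Rabs (x + - x0) <= t) by (apply Rabs_le; lra).
        assert (Rabs (y + - y0) <= t) by (apply Rabs_le; lra). lra. }
      assert (Hne : (x, y) <> (x0, y0)).
      { intros E; rewrite E in Hw; unfold z in Hw.
        replace ((x0, y0) - (x0, y0))%C with (RtoC 0) in Hw by ring.
        rewrite Cmod_0 in Hw; lra. }
      split; [apply Hsq; [lra|lra|exact Hne]|].
      specialize (Hd _ Hw2).
      set (w := (x, y) : C) in *.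
      set (h := Cmod (w - z)) in *.
      assert (Hwz : (w - z)%C <> 0) by (apply Cmod_gt_0; fold h; lra).
      unfold k, X.
      replace (L * (f w - f z) - L * l * (w - z))%C
        with (L * (f w - f z - (w - z) * l))%C by ring.
      rewrite Cmod_mult, Cmod_opp, Cmod_Ci, Cmod_div, !Cmod_mult
        by (apply Cmult_neq_0; assumption).
      rewrite HLm; fold h.
      assert (0 < h) by lra.
      apply Rle_trans with (1 * (n * (eps * h) / (h * h))).
      + apply Rmult_le_compat_l; [lra|]; unfold Rdiv.
        apply Rmult_le_compat_r; [left; apply Rinv_0_lt_compat; nra|].
        apply Rmult_le_compat_l; assumption.
      + replace (1 * (n * (eps * h) / (h * h))) with (n * eps * / h) by (field; lra).
        apply Rmult_le_compat_l; [nra|]. apply Rinv_le_contravar; assumption. }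
  (* The first term bounds the part of [k] without the pole. The second is the least gain from the
     pole, [n ^ 2 * s / r] with r the squared distance to the centre, reached at the corners where
     [r = 2 * s ^ 2]. *)
  set (m := n * (2 * M) / (s * s) - n ^ 2 / (2 * s)).
  assert (Hle : boundary_integral k (x0 - s) (x0 + s) (y0 - s) (y0 + s)
                <= 2 * ((x0 + s - (x0 - s)) + (y0 + s - (y0 - s))) * m).
  { assert (Y : forall x y, x0 - s <= x <= x0 + s -> y0 - s <= y <= y0 + s ->
      (Rabs (x - x0) = s \/ Rabs (y - y0) = s) ->
      ex_derive k (x, y) /\ exists u : C, Cmod u <= n * (2 * M) / (s * s) /\
        Re (k (x, y)) = Re u + n ^ 2 * (y - y0) / ((x - x0) ^ 2 + (y - y0) ^ 2) /\
        Im (k (x, y)) = Im u + n ^ 2 * (x - x0) / ((x - x0) ^ 2 + (y - y0) ^ 2) /\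
        s ^ 2 <= (x - x0) ^ 2 + (y - y0) ^ 2 <= 2 * s ^ 2).
    { intros x y Hx Hy Hb.
      assert (Hr : s ^ 2 <= (x - x0) ^ 2 + (y - y0) ^ 2 <= 2 * s ^ 2).
      { rewrite <- (pow2_abs (x - x0)), <- (pow2_abs (y - y0)).
        assert (Rabs (x - x0) <= s) by (apply Rabs_le; lra).
        assert (Rabs (y - y0) <= s) by (apply Rabs_le; lra).
        pose proof (Rabs_pos (x - x0)); pose proof (Rabs_pos (y - y0)).
        split; [destruct Hb as [->| ->]; nra|nra]. }
      assert (Hs2 : 0 < s ^ 2) by nra.
      assert (Hne : (x, y) <> (x0, y0)).
      { intros E; injection E; intros -> ->.
        rewrite !Rminus_diag in Hr; lra. }
      split; [apply Hsq; assumption|].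
      set (w := (x, y) : C).
      assert (Hh : Cmod (w - z) ^ 2 = (x - x0) ^ 2 + (y - y0) ^ 2)
        by (rewrite Cmod2_alt; unfold w, z, Re, Im; simpl; ring).
      assert (Hwz : (w - z)%C <> 0).
      { intros E; rewrite E, Cmod_0 in Hh; simpl in Hh; lra. }
      (* What remains of [k] once the pole i n^2 / (w-z) is split off. *)
      exists (- Ci * (L * (f w - f z) / ((w - z) * (w - z))))%C.
      assert (Ek : k w = (- Ci * (L * (f w - f z) / ((w - z) * (w - z)))
                          + Ci * (RtoC (n ^ 2) / (w - z)))%C).
      { unfold k, X; rewrite <- HLl; field; exact Hwz. }
      split; [|split; [|split; [|exact Hr]]].
      - rewrite Cmod_mult, Cmod_opp, Cmod_Ci, Cmod_div, !Cmod_mult, HLm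
          by (apply Cmult_neq_0; assumption).
        rewrite Rmult_1_l; unfold Rdiv.
        apply Rmult_le_compat.
        + apply Rmult_le_pos; [exact Hn|apply Cmod_ge_0].
        + left; apply Rinv_0_lt_compat; nra.
        + apply Rmult_le_compat_l; [exact Hn|].
          eapply Rle_trans; [apply Cmod_triangle|]; rewrite Cmod_opp.
          assert (Cmod (f w) <= M) by (apply Hf; unfold w; cbn [fst snd]; apply Rabs_le; lra).
          lra.
        + apply Rinv_le_contravar; nra.
      - fold w; rewrite Ek.
        generalize (- Ci * (L * (f w - f z) / ((w - z) * (w - z))))%C; intros u.
        unfold w, z, Re, Im; simpl; field; simpl in Hr; lra.
      - fold w; rewrite Ek.
        generalize (- Ci * (L * (f w - f z) / ((w - z) * (w - z))))%C; intros u.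
        unfold w, z, Re, Im; simpl; field; simpl in Hr; lra. }
    assert (Z : forall r, s ^ 2 <= r <= 2 * s ^ 2 -> n ^ 2 / (2 * s) <= n ^ 2 * s / r).
    { intros r Hr; unfold Rdiv; rewrite Rmult_assoc.
      apply Rmult_le_compat_l; [nra|].
      apply (Rmult_le_reg_r r); [nra|]. apply (Rmult_le_reg_l (2 * s)); [lra|].
      replace (2 * s * (/ (2 * s) * r)) with r by (field; lra).
      replace (2 * s * (s * / r * r)) with (2 * s ^ 2) by (field; nra). lra. }
    apply boundary_integral_le; try lra.
    - intros x Hx.
      destruct (Y x (y0 - s) Hx ltac:(lra)) as [D [u [U1 [U2 [U3 U4]]]]].
      { right; rewrite <- Rabs_Ropp, Rabs_pos_eq; lra. }
      split; [exact D|]; rewrite U2.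
      pose proof (re_le_Cmod u) as V; apply Rabs_le_between in V.
      specialize (Z _ U4); unfold m.
      replace (n ^ 2 * (y0 - s - y0)) with (- (n ^ 2 * s)) by ring.
      unfold Rdiv in *; lra.
    - intros x Hx.
      destruct (Y x (y0 + s) Hx ltac:(lra)) as [D [u [U1 [U2 [U3 U4]]]]].
      { right; rewrite Rabs_pos_eq; lra. }
      split; [exact D|]; rewrite U2.
      pose proof (re_le_Cmod u) as V; apply Rabs_le_between in V.
      specialize (Z _ U4); unfold m.
      replace (n ^ 2 * (y0 + s - y0)) with (n ^ 2 * s) by ring.
      unfold Rdiv in *; lra.
    - intros y Hy.
      destruct (Y (x0 + s) y ltac:(lra) Hy) as [D [u [U1 [U2 [U3 U4]]]]].
      { left; rewrite Rabs_pos_eq; lra. }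
      split; [exact D|]; rewrite U3.
      pose proof (im_le_Cmod u) as V; apply Rabs_le_between in V.
      specialize (Z _ U4); unfold m.
      replace (n ^ 2 * (x0 + s - x0)) with (n ^ 2 * s) by ring.
      unfold Rdiv in *; lra.
    - intros y Hy.
      destruct (Y (x0 - s) y ltac:(lra) Hy) as [D [u [U1 [U2 [U3 U4]]]]].
      { left; rewrite <- Rabs_Ropp, Rabs_pos_eq; lra. }
      split; [exact D|]; rewrite U3.
      pose proof (im_le_Cmod u) as V; apply Rabs_le_between in V.
      specialize (Z _ U4); unfold m.
      replace (n ^ 2 * (x0 - s - x0)) with (- (n ^ 2 * s)) by ring.
      unfold Rdiv in *; lra. }
  assert (Hm : 0 <= 8 * (s * m)) by lra.
  assert (E : 2 * (s * s) * (s * m) = s * n * (4 * M - n * s)) by (unfold m; field; lra).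
  apply (Rmult_le_reg_r s); [exact Hs|].
  replace (4 * M / s * s) with (4 * M) by (field; lra).
  (* The inequality obtained so far is [n * (4 * M - n * s) >= 0] up to a positive factor; a nonzero
     [n] can be cancelled. *)
  destruct (Req_dec n 0) as [->|Hn0]; [lra|].
  assert (0 < s * n) by (apply Rmult_lt_0_compat; lra).
  nra.
Qed.

(** * Growth of a function and of its derivative *)

Lemma sup_disk_finite (h : C -> R) :
  Rbar_lt (sup_disk h) p_infty <->
  exists K : R, forall z : C, unit_disk z -> h z <= K.
Proof.
  unfold sup_disk.
  destruct (Lub_Rbar_correct (fun y => exists z : C, unit_disk z /\ y = h z)) as [U L].
  split.
  - intros Hlt; destruct (Lub_Rbar _) as [K| |]; [|contradiction|].
    + exists K; intros z Hz; exact (U (h z) (ex_intro _ z (conj Hz eq_refl))).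
    (* A supremum [m_infty] would lie above the real number [h z], which is absurd; the witness is
       arbitrary. *)
    + exists 0; intros z Hz; destruct (U (h z) (ex_intro _ z (conj Hz eq_refl))).
  - intros [K HK].
    apply Rbar_le_lt_trans with (Finite K); [|exact I].
    apply L; intros y [z [Hz ->]]; exact (HK z Hz).
Qed.

Lemma Rpower_le_exponent (b p q : R) :
  0 < b <= 1 -> p <= q -> Rpower b q <= Rpower b p.
Proof.
  intros Hb Hpq; replace q with (p + (q - p)) by ring; rewrite Rpower_plus.
  rewrite <- (Rmult_1_r (Rpower b p)) at 2.
  apply Rmult_le_compat_l; [left; apply exp_pos|].
  apply Rle_trans with (Rpower 1 (q - p)); [apply Rle_Rpower_l; lra|].
  unfold Rpower; rewrite ln_1, Rmult_0_r, exp_0; lra.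
Qed.

Lemma Hinf_Bloch_space (alpha : R) (f : C -> C) :
  0 <= alpha -> Hinf alpha f -> Bloch_space (1 + alpha) f.
Proof.
  intros Ha [Hf Hs]; split; [exact Hf|].
  apply sup_disk_finite; apply sup_disk_finite in Hs; destruct Hs as [K HK].
  (* On the square of half-side r/4 around z one has 1-|w| >= r/2, so M = K (r/2)^(-alpha) serves in
     Cauchy's estimate, and 4M/(r/4) = 16M/r. *)
  exists (16 * K * Rpower (/ 2) (- alpha)); intros z Hz.
  unfold unit_disk in *; unfold v in *.
  set (r := 1 - Cmod z) in *.
  assert (Hr : 0 < r) by (unfold r; lra).
  assert (H : Cmod (C_derive f z) <= 4 * (K * Rpower (r / 2) (- alpha)) / (r / 4)).
  { apply cauchy_estimate with f z; [lra| |].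
    - apply C_derive_correct; [exact z|apply Hf, Hz].
    - intros w Hre Him.
      assert (Hw : r / 2 <= 1 - Cmod w).
      { pose proof (Cmod_triangle z (w - z)%C) as T.
        replace (z + (w - z))%C with w in T by ring.
        pose proof (Cmod_le_abs (w - z)%C) as T'.
        replace (Re (w - z)%C) with (Re w - Re z) in T' by (unfold Re; simpl; ring).
        replace (Im (w - z)%C) with (Im w - Im z) in T' by (unfold Im; simpl; ring).
        unfold r in *; lra. }
      split; [apply Hf; unfold unit_disk; lra|].
      specialize (HK w ltac:(lra)).
      assert (P : 0 < Rpower (r / 2) alpha) by apply exp_pos.
      assert (Q : Rpower (r / 2) alpha <= Rpower (1 - Cmod w) alpha)
        by (apply Rle_Rpower_l; lra).
      rewrite Rpower_Ropp.
      apply (Rmult_le_reg_r (Rpower (r / 2) alpha)); [exact P|].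
      rewrite Rmult_assoc, Rinv_l by lra.
      pose proof (Cmod_ge_0 (f w)); nra. }
  apply (Rmult_le_compat_r (Rpower r (1 + alpha))) in H; [|left; apply exp_pos].
  eapply Rle_trans; [exact H|]; apply Req_le.
  unfold Rdiv at 2; rewrite <- Rpower_mult_distr by lra.
  rewrite Rpower_plus, Rpower_1, (Rpower_Ropp r) by lra.
  field; split; [apply Rgt_not_eq, exp_pos|lra].
Qed.

(** * From the derivative back to the function, along rays *)

Lemma is_R_derive_eps (f : R -> R) (x l : R) :
  is_derive f x l <->
  forall eps : R, 0 < eps -> exists delta : R, 0 < delta /\
    forall t : R, Rabs (t - x) < delta ->
      Rabs (f t - f x - (t - x) * l) <= eps * Rabs (t - x).
Proof.
  split.
  - intros [_ H] eps Heps.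
    destruct (H x (fun P HP => HP) (mkposreal eps Heps)) as [d Hd].
    exists d; split; [apply cond_pos|]; intros t Ht; exact (Hd t Ht).
  - intros H; split; [apply is_linear_scal_l|].
    intros y Hy eps; rewrite <- (is_filter_lim_locally_unique _ _ Hy).
    destruct (H eps (cond_pos eps)) as [d [Hd1 Hd2]].
    exists (mkposreal d Hd1); intros t Ht; exact (Hd2 t Ht).
Qed.

Lemma is_derive_Re_real_line (F : C -> C) (t : R) (l : C) :
  is_derive F (RtoC t) l -> is_derive (fun x : R => Re (F (RtoC x))) t (Re l).
Proof.
  intros HF; apply is_R_derive_eps; intros eps Heps.
  destruct (proj1 (is_C_derive_eps F t l) HF eps Heps) as [d [Hd H]].
  exists d; split; [exact Hd|]; intros x Hx.
  rewrite <- Cmod_R, RtoC_minus in Hx.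
  specialize (H (RtoC x) Hx).
  rewrite <- (Cmod_R (x - t)), RtoC_minus.
  eapply Rle_trans; [|exact H]; eapply Rle_trans; [|apply re_le_Cmod].
  apply Req_le; f_equal; unfold Re; simpl; ring.
Qed.

(** Integration is replaced by monotonicity. Multiplying by [Cconj u] turns the increment of [f]
    into the real number |u|^2, and the real part is compared on [0,1] with a primitive of the
    assumed bound; the mean value theorem shows that the difference does not increase. *)
Lemma Bloch_growth (beta K : R) (f : C -> C) (z : C) :
  1 < beta -> holomorphic_on_disk f ->
  (forall w : C, unit_disk w -> Cmod (C_derive f w) * v beta w <= K) ->
  unit_disk z ->
  Cmod (f z - f 0) <= K / (beta - 1) * Rpower (1 - Cmod z) (1 - beta).
Proof.
  intros Hb Hf HK Hz; unfold unit_disk, v in *.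
  set (u := (f z - f 0)%C); set (n := Cmod u); set (r := Cmod z) in *.
  assert (Hr : 0 <= r) by apply Cmod_ge_0.
  assert (Hn : 0 <= n) by apply Cmod_ge_0.
  assert (HK0 : 0 <= K).
  { eapply Rle_trans; [|apply (HK z Hz)].
    apply Rmult_le_pos; [apply Cmod_ge_0|left; apply exp_pos]. }
  assert (Htz : forall t, 0 <= t <= 1 -> 1 - Cmod (RtoC t * z) = 1 - t * r /\ t * r < 1).
  { intros t Ht; rewrite Cmod_mult, Cmod_R, Rabs_pos_eq by lra; fold r; nra. }
  set (psi := fun t => K / (beta - 1) * Rpower (1 - t * r) (1 - beta)).
  set (D := fun t => Re (Cconj u * f (RtoC t * z))%C - n * psi t).
  set (dD := fun t => Re (z * (Cconj u * C_derive f (RtoC t * z)))%C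
                      - n * (K * r * Rpower (1 - t * r) (- beta))).
  assert (HD : forall t, 0 <= t <= 1 -> is_derive D t (dD t)).
  { intros t Ht; destruct (Htz t Ht) as [E Htr].
    apply (is_derive_minus (V := R_NormedModule)).
    - apply (is_derive_Re_real_line (fun w => (Cconj u * f (w * z))%C)).
      apply (is_C_derive_comp (fun w => (Cconj u * f w)%C) (fun w => (w * z)%C)).
      + pose proof (is_C_derive_mult (fun _ => Cconj u) f (RtoC t * z)%C 0
          (C_derive f (RtoC t * z))) as M.
        replace (Cconj u * C_derive f (RtoC t * z))%C
          with (0 * f (RtoC t * z) + Cconj u * C_derive f (RtoC t * z))%C by ring.
        apply M; [apply is_C_derive_const|].
        apply C_derive_correct; [exact z|apply Hf; unfold unit_disk; lra].
      + pose proof (is_C_derive_mult _ _ (RtoC t) _ _ (is_C_derive_id (RtoC t))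
          (is_C_derive_const z (RtoC t))) as M; cbn beta in M.
        replace (1 * z + RtoC t * 0)%C with z in M by ring; exact M.
    - unfold psi, Rpower; auto_derive; [lra|].
      replace (- beta * ln (1 - t * r)) with ((1 - beta) * ln (1 - t * r) + - ln (1 - t * r))
        by ring.
      rewrite exp_plus, exp_Ropp, exp_ln by lra.
      change (1 + - (t * r)) with (1 - t * r); field; lra. }
  destruct (MVT_gen D 0 1 dD) as [c [Hc HE]].
  - intros x Hx; rewrite Rmin_left, Rmax_right in Hx by lra; apply HD; lra.
  - intros x Hx; rewrite Rmin_left, Rmax_right in Hx by lra.
    apply continuity_pt_filterlim, (ex_derive_continuous (V := R_NormedModule) D).
    exists (dD x); apply HD; lra.
  - rewrite Rmin_left, Rmax_right in Hc by lra.
    assert (HdD : dD c <= 0).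
    { unfold dD; destruct (Htz c Hc) as [E Hcr].
      specialize (HK (RtoC c * z)%C ltac:(lra)); rewrite E in HK.
      pose proof (re_le_Cmod (z * (Cconj u * C_derive f (RtoC c * z)))%C) as T.
      rewrite !Cmod_mult, Cmod_conj in T; fold r n in T.
      apply Rabs_le_between in T.
      set (m := Cmod (C_derive f (RtoC c * z))) in *.
      assert (P : 0 < Rpower (1 - c * r) beta) by apply exp_pos.
      assert (Q : m <= K * Rpower (1 - c * r) (- beta)).
      { rewrite Rpower_Ropp; apply (Rmult_le_reg_r (Rpower (1 - c * r) beta)); [exact P|].
        rewrite Rmult_assoc, Rinv_l by lra; lra. }
      apply (Rmult_le_compat_l (r * n)) in Q; [|nra]. lra. }
    assert (E1 : D 1 - D 0 = n * n - n * (psi 1 - psi 0)).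
    { unfold D.
      replace (RtoC 1 * z)%C with z by ring; replace (RtoC 0 * z)%C with (RtoC 0) by ring.
      assert (N : Re (Cconj u * f z)%C - Re (Cconj u * f 0)%C = n * n).
      { replace (Re (Cconj u * f z)%C - Re (Cconj u * f 0)%C) with (Re (u * Cconj u)%C)
          by (unfold u, Re, Cconj; simpl; ring).
        rewrite <- Cmod2_conj; fold n; unfold Re; simpl; ring. }
      lra. }
    assert (P0 : 0 <= psi 0).
    { apply Rmult_le_pos; [|left; apply exp_pos].
      apply Rle_mult_inv_pos; lra. }
    replace (K / (beta - 1) * Rpower (1 - r) (1 - beta)) with (psi 1)
      by (unfold psi; rewrite Rmult_1_l; reflexivity).
    destruct (Req_dec n 0) as [H0|H0].
    + rewrite H0; apply Rmult_le_pos; [apply Rle_mult_inv_pos; lra|left; apply exp_pos].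
    + assert (n * (n - psi 1) <= 0) by nra. nra.
Qed.

(** The slack in [beta <= 1 + alpha] covers beta = 1, where no power primitive exists: on the disk
    the weight decreases in its exponent, so the Bloch bound also holds with exponent
    [1 + alpha > 1], to which [Bloch_growth] applies. *)
Lemma Bloch_space_Hinf (beta alpha : R) (f : C -> C) :
  0 < alpha -> beta <= 1 + alpha -> Bloch_space beta f -> Hinf alpha f.
Proof.
  intros Ha Hb [Hf Hs]; split; [exact Hf|].
  apply sup_disk_finite; apply sup_disk_finite in Hs; destruct Hs as [K HK].
  exists (Cmod (f 0) + K / alpha); intros z Hz.
  assert (G := Bloch_growth (1 + alpha) K f z ltac:(lra) Hf).
  lapply G; clear G; [intros G|].
  2: { intros w Hw; eapply Rle_trans; [|apply (HK w Hw)].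
       apply Rmult_le_compat_l; [apply Cmod_ge_0|].
       pose proof (Cmod_ge_0 w); unfold unit_disk in Hw.
       apply Rpower_le_exponent; lra. }
  specialize (G Hz); unfold unit_disk, v in *.
  replace (1 + alpha - 1) with alpha in G by ring.
  replace (1 - (1 + alpha)) with (- alpha) in G by ring.
  rewrite Rpower_Ropp in G.
  set (P := Rpower (1 - Cmod z) alpha) in *.
  assert (P0 : 0 < P) by apply exp_pos.
  assert (P1 : P <= 1).
  { pose proof (Cmod_ge_0 z).
    rewrite <- (Rpower_O (1 - Cmod z)) by lra.
    apply Rpower_le_exponent; lra. }
  assert (T : Cmod (f z) <= Cmod (f 0) + Cmod (f z - f 0)).
  { replace (f z) with (f 0 + (f z - f 0))%C at 1 by ring; apply Cmod_triangle. }
  apply Rle_trans with ((Cmod (f 0) + K / alpha * / P) * P).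
  - apply Rmult_le_compat_r; lra.
  - replace ((Cmod (f 0) + K / alpha * / P) * P) with (Cmod (f 0) * P + K / alpha)
      by (field; lra).
    pose proof (Cmod_ge_0 (f 0)); nra.
Qed.

(** * The atomic inner function *)

Definition Cexp (z : C) : C := (exp (Re z) * cos (Im z), exp (Re z) * sin (Im z)).

Lemma Cmod_Cexp (z : C) : Cmod (Cexp z) = exp (Re z).
Proof.
  pose proof (exp_pos (Re z)) as P.
  unfold Cmod, Cexp; cbn [fst snd].
  replace ((exp (Re z) * cos (Im z)) ^ 2 + (exp (Re z) * sin (Im z)) ^ 2)
    with (exp (Re z) ^ 2 * ((sin (Im z))² + (cos (Im z))²)) by (unfold Rsqr; ring).
  rewrite sin2_cos2, Rmult_1_r; apply sqrt_pow2; lra.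
Qed.

Lemma Cexp_plus (z w : C) : Cexp (z + w) = (Cexp z * Cexp w)%C.
Proof.
  destruct z as [x y], w as [x' y']; unfold Cexp, Cmult, Re, Im; simpl.
  rewrite exp_plus, cos_plus, sin_plus; f_equal; ring.
Qed.

Lemma Cexp_derive_0 (eps : R) :
  0 < eps -> exists delta : R, 0 < delta /\
    forall h : C, Cmod h < delta -> Cmod (Cexp h - 1 - h) <= eps * Cmod h.
Proof.
  (* The real part of the remainder costs [4 * e] and the imaginary part [5 * e]; the cap 1 gives
     |x| < 1 and hence [exp x <= 3]. *)
  intros Heps; set (e := Rmin (eps / 9) 1).
  assert (He : 0 < e) by (apply Rmin_pos; lra).
  assert (He1 : e <= 1) by apply Rmin_r.
  assert (He9 : e <= eps / 9) by apply Rmin_l.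
  destruct (proj1 (is_R_derive_eps exp 0 (exp 0)) (is_derive_exp 0) e He)
    as [d1 [Hd1 H1]].
  destruct (proj1 (is_R_derive_eps cos 0 (- sin 0)) (is_derive_cos 0) e He)
    as [d2 [Hd2 H2]].
  destruct (proj1 (is_R_derive_eps sin 0 (cos 0)) (is_derive_sin 0) e He)
    as [d3 [Hd3 H3]].
  exists (Rmin (Rmin d1 d2) (Rmin d3 e)); split; [repeat apply Rmin_pos; lra|].
  intros h Hh.
  pose proof (Rmin_l (Rmin d1 d2) (Rmin d3 e)); pose proof (Rmin_r (Rmin d1 d2) (Rmin d3 e)).
  pose proof (Rmin_l d1 d2); pose proof (Rmin_r d1 d2).
  pose proof (Rmin_l d3 e); pose proof (Rmin_r d3 e).
  pose proof (re_le_Cmod h) as Hx; pose proof (im_le_Cmod h) as Hy.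
  rewrite exp_0 in H1; rewrite cos_0, sin_0 in H2; rewrite cos_0, sin_0 in H3.
  specialize (H1 (Re h)); specialize (H2 (Im h)); specialize (H3 (Im h)).
  rewrite !Rminus_0_r in H1, H2, H3.
  specialize (H1 ltac:(lra)); specialize (H2 ltac:(lra)); specialize (H3 ltac:(lra)).
  set (x := Re h) in *; set (y := Im h) in *; set (m := Cmod h) in *.
  assert (K1 : Rabs (exp x - 1) <= 2 * Rabs x).
  { replace (exp x - 1) with ((exp x - 1 - x * 1) + x) by ring.
    pose proof (Rabs_triang (exp x - 1 - x * 1) x); pose proof (Rabs_pos x); nra. }
  assert (K2 : Rabs (exp x) <= 3).
  { replace (exp x) with ((exp x - 1) + 1) by ring.
    pose proof (Rabs_triang (exp x - 1) 1); rewrite Rabs_R1 in *; lra. }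
  assert (Are : Rabs (Re (Cexp h - 1 - h)%C) <= 4 * e * m).
  { replace (Re (Cexp h - 1 - h)%C)
      with ((exp x - 1 - x * 1) + exp x * (cos y - 1 - y * - 0))
      by (unfold Cexp, x, y, Re, Im; simpl; ring).
    eapply Rle_trans; [apply Rabs_triang|]; rewrite Rabs_mult.
    assert (Rabs (exp x) * Rabs (cos y - 1 - y * - 0) <= 3 * (e * m))
      by (apply Rmult_le_compat; [apply Rabs_pos|apply Rabs_pos|lra|nra]).
    nra. }
  assert (Aim : Rabs (Im (Cexp h - 1 - h)%C) <= 5 * e * m).
  { replace (Im (Cexp h - 1 - h)%C)
      with (exp x * (sin y - 0 - y * 1) + y * (exp x - 1))
      by (unfold Cexp, x, y, Re, Im; simpl; ring).
    eapply Rle_trans; [apply Rabs_triang|]; rewrite !Rabs_mult.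
    assert (Rabs (exp x) * Rabs (sin y - 0 - y * 1) <= 3 * (e * m))
      by (apply Rmult_le_compat; [apply Rabs_pos|apply Rabs_pos|lra|rewrite Rminus_0_r in *; nra]).
    assert (Rabs y * Rabs (exp x - 1) <= m * (2 * e))
      by (apply Rmult_le_compat; [apply Rabs_pos|apply Rabs_pos|lra|lra]).
    nra. }
  eapply Rle_trans; [apply Cmod_le_abs|].
  assert (0 <= m) by apply Cmod_ge_0. nra.
Qed.

(** The functional equation carries the derivative at 0 to every point. *)
Lemma is_derive_Cexp (z : C) : is_derive Cexp z (Cexp z).
Proof.
  apply is_C_derive_eps; intros eps Heps.
  pose proof (exp_pos (Re z)) as P.
  destruct (Cexp_derive_0 (eps / exp (Re z))) as [d [Hd H]];
    [apply Rdiv_lt_0_compat; lra|].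
  exists d; split; [exact Hd|]; intros w Hw; specialize (H _ Hw).
  replace (Cexp w) with (Cexp z * Cexp (w - z))%C
    by (rewrite <- Cexp_plus; f_equal; ring).
  replace (Cexp z * Cexp (w - z) - Cexp z - (w - z) * Cexp z)%C
    with (Cexp z * (Cexp (w - z) - 1 - (w - z)))%C by ring.
  rewrite Cmod_mult, Cmod_Cexp.
  apply (Rmult_le_compat_l (exp (Re z))) in H; [|lra].
  eapply Rle_trans; [exact H|]; apply Req_le; field; lra.
Qed.

(* The atomic inner function [exp (-(1+z)/(1-z))] up to the factor [exp 1]: on
   the horocycle [Re (1/(1-z)) = 1] its modulus is constant while its derivative
   grows like [1/(1-|z|)]. *)
Definition atomic_inner (z : C) : C := Cexp (- (2) * / (1 - z))%C.

Lemma one_minus_disk_neq_0 (z : C) : unit_disk z -> (1 - z)%C <> 0.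
Proof.
  intros Hz E; unfold unit_disk in Hz.
  replace z with (1 - (1 - z))%C in Hz by ring.
  rewrite E in Hz; replace (1 - 0)%C with (RtoC 1) in Hz by ring.
  rewrite Cmod_1 in Hz; lra.
Qed.

Lemma is_derive_atomic_inner (z : C) :
  unit_disk z ->
  is_derive atomic_inner z (- (2) * / ((1 - z) * (1 - z)) * atomic_inner z)%C.
Proof.
  intros Hz; pose proof (one_minus_disk_neq_0 z Hz) as H1.
  apply (is_C_derive_comp Cexp (fun w => (- (2) * / (1 - w))%C)); [apply is_derive_Cexp|].
  assert (D1 : is_derive (fun w : C => (1 - w)%C) z (- (1))%C).
  { replace (- (1))%C with (0 - 1)%C by ring.
    exact (is_derive_minus (V := C_NormedModule) _ _ z _ _
      (is_C_derive_const 1 z) (is_C_derive_id z)). }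
  pose proof (is_C_derive_comp Cinv (fun w => (1 - w)%C) z _ _
    (is_C_derive_inv _ H1) D1) as D2.
  pose proof (is_C_derive_mult _ _ z _ _ (is_C_derive_const (- (2))%C z) D2) as D3.
  cbn beta in D3.
  replace (- (2) * / ((1 - z) * (1 - z)))%C
    with (0 * / (1 - z) + - (2) * (- (1) * - / ((1 - z) * (1 - z))))%C
    by (field; exact H1).
  exact D3.
Qed.

(** The map 1/(1-z) sends the disk into the right half-plane, so the exponent has negative real
    part. *)
Lemma atomic_inner_le_1 (z : C) : unit_disk z -> Cmod (atomic_inner z) <= 1.
Proof.
  intros Hz; unfold atomic_inner; rewrite Cmod_Cexp.
  assert (Hx : Re z < 1).
  { pose proof (re_le_Cmod z) as H; apply Rabs_le_between in H.
    unfold unit_disk in Hz; lra. }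
  assert (E : Re (- (2) * / (1 - z))%C
    = - (2 * (1 - Re z) / ((1 - Re z) ^ 2 + (Im z) ^ 2))).
  { destruct z as [x y]; unfold Re, Im in *; simpl in *; field; simpl; nra. }
  rewrite E.
  assert (0 < 2 * (1 - Re z) / ((1 - Re z) ^ 2 + (Im z) ^ 2))
    by (apply Rdiv_lt_0_compat;
        [lra|pose proof (pow2_ge_0 (Im z)); pose proof (pow_lt (1 - Re z) 2 ltac:(lra)); lra]).
  eapply Rle_trans; [|apply Req_le, exp_0].
  left; apply exp_increasing; lra.
Qed.

Lemma atomic_inner_horocycle (X : R) :
  (* The horocycle is parametrised by u = 1/(1-z) = 1 + iy. The derivative has modulus 2|u|^2
     exp(-2), which dictates |u|^2 = X/2; a real y then exists because X >= 2. *)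
  2 <= X -> exists z : C, unit_disk z /\ / X <= 1 - Cmod z /\
    Cmod (- (2) * / ((1 - z) * (1 - z)) * atomic_inner z) = X * exp (- 2).
Proof.
  intros HX; set (y := sqrt (X / 2 - 1)).
  assert (Hy : y * y = X / 2 - 1) by (apply sqrt_sqrt; lra).
  set (u := (1, y) : C).
  assert (Hu2 : Cmod u ^ 2 = X / 2)
    by (rewrite Cmod2_alt; unfold u, Re, Im; simpl; lra).
  assert (Hu : u <> 0) by (intros E; injection E; lra).
  set (z := (1 - / u)%C).
  assert (H1z : (1 - z)%C = (/ u)%C) by (unfold z; ring).
  assert (Hz2 : Cmod z ^ 2 = 1 - 2 * / X).
  { assert (Ez : (z * u)%C = (Ci * RtoC y)%C).
    { unfold z; replace ((1 - / u) * u)%C with (u - 1)%C by (field; exact Hu).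
      unfold u, Ci, RtoC, Cminus, Cplus, Copp, Cmult; simpl; f_equal; ring. }
    assert (Em : (Cmod z * Cmod u) ^ 2 = y * y).
    { rewrite <- Cmod_mult, Ez, Cmod_mult, Cmod_Ci, Cmod_R, Rmult_1_l, pow2_abs; ring. }
    rewrite Rpow_mult_distr, Hu2, Hy in Em.
    apply (Rmult_eq_reg_r (X / 2)); [|lra]. rewrite Em; field; lra. }
  assert (HiX : 0 < / X) by (apply Rinv_0_lt_compat; lra).
  assert (Hz : unit_disk z).
  { unfold unit_disk; pose proof (Cmod_ge_0 z); nra. }
  exists z; split; [exact Hz|]; unfold unit_disk in Hz; split.
  (* Here (1-|z|)(1+|z|) = 2/X, and 1+|z| <= 2. *)
  - pose proof (Cmod_ge_0 z); nra.
  - unfold atomic_inner; rewrite H1z.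
    replace (/ (/ u * / u))%C with (u * u)%C by (field; exact Hu).
    replace (/ / u)%C with u by (field; exact Hu).
    rewrite !Cmod_mult, Cmod_Cexp, Cmod_opp, Cmod_R, Rabs_pos_eq by lra.
    replace (Re (- (2) * u)%C) with (- 2) by (unfold u, Re; simpl; ring).
    replace (2 * (Cmod u * Cmod u)) with (2 * Cmod u ^ 2) by ring.
    rewrite Hu2; field.
Qed.

(** * Admissible exponents and their infima *)

(** For beta < 1 the weighted derivative of a scaled copy of [atomic_inner] is at least a constant
    times X^(1-beta) on the horocycle, which is unbounded in X. *)
Lemma Bloch_exponent_ge_1 (Omega : C -> Prop) (beta : R) :
  (exists z, Omega z) -> open Omega -> 0 < beta ->
  (forall f, Hol Omega f -> Bloch_space beta f) -> 1 <= beta.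
Proof.
  intros [a Ha] Ho Hb H; apply Rnot_lt_le; intros Hlt.
  (* [locally_C] provides a neighbourhood that is a disk for [Cmod]. *)
  destruct (proj1 (locally_C a Omega) (Ho a Ha)) as [rho Hrho].
  set (c := rho / 2).
  assert (Hc : 0 < c < rho) by (pose proof (cond_pos rho); unfold c; lra).
  set (f := fun z : C => (a + RtoC c * atomic_inner z)%C).
  assert (Hd : forall z, unit_disk z -> is_derive f z
    (RtoC c * (- (2) * / ((1 - z) * (1 - z)) * atomic_inner z))%C).
  { intros z Hz.
    pose proof (is_C_derive_mult _ _ z _ _ (is_C_derive_const (RtoC c) z)
      (is_derive_atomic_inner z Hz)) as D1; cbn beta in D1.
    pose proof (is_derive_plus (V := C_NormedModule) _ _ z _ _
      (is_C_derive_const a z) D1) as D2.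
    unfold plus in D2; simpl in D2.
    match type of D2 with is_derive _ _ ?l =>
      replace (RtoC c * (- (2) * / ((1 - z) * (1 - z)) * atomic_inner z))%C with l
        by ring end.
    exact D2. }
  assert (Hf : Hol Omega f).
  { split; [intros z Hz; eexists; apply Hd, Hz|].
    intros z Hz; apply Hrho.
    change (Cmod (f z - a) < rho).
    unfold f; replace (a + RtoC c * atomic_inner z - a)%C
      with (RtoC c * atomic_inner z)%C by ring.
    rewrite Cmod_mult, Cmod_R, Rabs_pos_eq by lra.
    pose proof (atomic_inner_le_1 z Hz); pose proof (Cmod_ge_0 (atomic_inner z)); nra. }
  destruct (H f Hf) as [_ Hs]; apply sup_disk_finite in Hs; destruct Hs as [K HK].
  set (e2 := exp (- 2)); assert (He2 : 0 < e2) by apply exp_pos.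
  (* Chosen so that [c * e2 * Y] exceeds [K]; below, X satisfies X^(1-beta) >= Y and the condition X
     >= 2 of the horocycle lemma. *)
  set (Y := (Rabs K + 1) / (c * e2)).
  assert (Hce : 0 < c * e2) by nra.
  assert (HY : 0 < Y) by (apply Rdiv_lt_0_compat; [pose proof (Rabs_pos K); lra|lra]).
  set (X := Rmax 2 (Rpower Y (/ (1 - beta)))).
  assert (HX2 : 2 <= X) by apply Rmax_l.
  assert (HXY : Y <= Rpower X (1 - beta)).
  { replace Y with (Rpower (Rpower Y (/ (1 - beta))) (1 - beta)).
    - apply Rle_Rpower_l; [lra|]; split; [apply exp_pos|apply Rmax_r].
    - rewrite Rpower_mult, Rinv_l, Rpower_1 by lra; reflexivity. }
  destruct (atomic_inner_horocycle X HX2) as [z [Hz [HzX Hzd]]].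
  specialize (HK z Hz).
  rewrite (is_C_derive_unique _ _ _ (Hd z Hz)), Cmod_mult, Hzd in HK.
  rewrite Cmod_R, Rabs_pos_eq in HK by lra; fold e2 in HK; unfold v in HK.
  assert (Hv : Rpower X (- beta) <= Rpower (1 - Cmod z) beta).
  { replace (Rpower X (- beta)) with (Rpower (/ X) beta).
    - apply Rle_Rpower_l; [lra|]; split; [apply Rinv_0_lt_compat; lra|exact HzX].
    - unfold Rpower; rewrite ln_Rinv by lra; f_equal; ring. }
  assert (HXX : Rpower X (1 - beta) = X * Rpower X (- beta)).
  { unfold Rminus; rewrite Rpower_plus, Rpower_1 by lra; reflexivity. }
  assert (Q : c * e2 * Y <= K).
  { eapply Rle_trans; [|exact HK].
    replace (c * (X * e2) * Rpower (1 - Cmod z) beta)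
      with (c * e2 * (X * Rpower (1 - Cmod z) beta)) by ring.
    apply Rmult_le_compat_l; [lra|]. eapply Rle_trans; [exact HXY|].
    rewrite HXX; apply Rmult_le_compat_l; lra. }
  replace (c * e2 * Y) with (Rabs K + 1) in Q by (unfold Y; field; lra).
  pose proof (Rle_abs K); lra.
Qed.

Theorem corollary8p5 (Omega : C -> Prop) (hOmega : complex_domain Omega) :
  Bloch Omega = Rbar_plus (Finite 1) (g Omega).
Proof.
  destruct hOmega as [Hne [Ho _]].
  apply is_glb_Rbar_unique; unfold g.
  match goal with |- context [Glb_Rbar ?E] =>
    destruct (Glb_Rbar_correct E) as [Hlb Hglb]; set (gO := Glb_Rbar E) in * end.
  split.
  - intros beta [Hb HB].
    assert (H1 := Bloch_exponent_ge_1 Omega beta Hne Ho Hb HB).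
    (* The exponent [beta - 1] may be 0, whereas those of [g] are positive; together with
       [1 <= beta], eps restores positivity. *)
    assert (Hg : forall eps, 0 < eps -> Rbar_le gO (beta - 1 + eps)).
    { intros eps Heps; apply Hlb; split; [lra|].
      intros f Hf; apply (Bloch_space_Hinf beta); [lra|lra|apply HB, Hf]. }
    destruct gO as [r| |].
    + change (1 + r <= beta); apply Rnot_lt_le; intros Hlt.
      specialize (Hg ((1 + r - beta) / 2) ltac:(lra)); simpl in Hg; lra.
    + destruct (Hg 1 Rlt_0_1).
    + exact I.
  - intros b Hbl.
    assert (Hb : forall alpha, 0 < alpha -> (forall f, Hol Omega f -> Hinf alpha f) ->
      Rbar_le b (1 + alpha)).
    { intros alpha Ha HA; apply Hbl; split; [lra|].
      intros f Hf; apply Hinf_Bloch_space; [lra|apply HA, Hf]. }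
    destruct b as [b| |]; [| |exact I].
    + assert (G : Rbar_le (b - 1) gO).
      { apply Hglb; intros alpha [Ha HA]; specialize (Hb alpha Ha HA); simpl in *; lra. }
      destruct gO as [r| |]; simpl in *; [lra|exact I|exact G].
    (* The lower bound [p_infty] excludes every admissible alpha, since [1 + alpha] is finite; both
       infima are then infinite. *)
    + assert (G : Rbar_le p_infty gO).
      { apply Hglb; intros alpha [Ha HA]; exact (Hb alpha Ha HA). }
      destruct gO; simpl in *; tauto.
Qed.
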